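(* Let $w_n$ be the number of weak-ordering chains in $\mathcal{WOC}(n)$ subject to the stopping condition $x_i<x_j$ with $i<j$ (i.e. a chain contains the stopping condition if there are indices $i<j$ with $x_i<x_j$ in the chain). Then $w_n=(n-1)2^{n-1}+1$ for all $n\ge1$. The sequence starts $1,3,9,25,65,161,385,897,\dots$.
   Context: A weak-ordering chain on $x_1,\dots,x_m$ is an expression $x_{i_1}\,\mathrm{op}\,x_{i_2}\,\mathrm{op}\cdots\mathrm{op}\,x_{i_m}$, where $(i_1,\dots,i_m)$ is an ordering of $[m]=\{1,\dots,m\}$ and each $\mathrm{op}$ is $<$ or $=$; two expressions defining the same ordered set partition of $[m]$ (blocks = index sets of equal variables, ordered by increasing value) are identified. $\mathcal{WOC}(m)$ is the set of these chains. Each chain in $\mathcal{WOC}(m)$, $m\ge 2$, arises uniquely from its restriction to $x_1,\dots,x_{m-1}$ (a chain in $\mathcal{WOC}(m-1)$) by inserting $x_m$; this gives a rooted tree with root $x_1$ whose level-$m$ nodes are the elements of $\mathcal{WOC}(m)$. Given a stopping condition, the restricted generating tree of order $n$ is the part of this tree up to level $n$ in which any node whose chain contains the stopping condition has no descendants. Its leaves are the nodes at level $n$ together with the nodes containing the stopping condition. ''The number of weak-ordering chains in $\mathcal{WOC}(n)$ subject to the stopping condition'' means the number of leaves of this restricted tree of order $n$; equivalently, the number of chains in $\mathcal{WOC}(n)$ not containing the condition plus, for each $1\le j\le n$, the number of chains in $\mathcal{WOC}(j)$ that contain the condition while their restriction to $x_1,\dots,x_{j-1}$ does not. *)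

(* Defs.v *)
From HB Require Import structures.
From mathcomp Require Import all_boot.

Set Implicit Arguments.
Unset Strict Implicit.
Unset Printing Implicit Defensive.

(** A weak-ordering chain on [m] variables is an ordered set partition of its
    index set: the sequence of its blocks, by increasing value.  Indices are
    shifted by one: [i : 'I_m] stands for the variable x_(i+1). *)
Definition is_woc (m : nat) (c : seq {set 'I_m}) : bool :=
  uniq c && partition [set B in c] [set: 'I_m].

Lemma size_woc (m : nat) (c : seq {set 'I_m}) : is_woc c -> size c <= m.
Proof.
case/andP=> c_uniq c_part; have := card_partition c_part.
rewrite cardsT card_ord => cardE; rewrite [leqRHS]cardE.
have /card_uniqP <- := c_uniq.
have -> : #|c| = #|[set B in c]| by rewrite cardsE.
rewrite -sum1_card; apply: leq_sum => B cB; rewrite card_gt0.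
by apply: contraTneq cB => ->; case/and3P: c_part.
Qed.

(** By [size_woc] the bound on the length loses no chain; it only makes the
    type of candidates finite. *)
Definition WOC (m : nat) : {set {bseq m of {set 'I_m}}} :=
  [set c : {bseq m of {set 'I_m}} | is_woc c].

(** Restriction to the first [j] variables: the ancestor at level [j] in the
    generating tree. *)
Definition restrict (j m : nat) (le_jm : j <= m) (c : seq {set 'I_m}) :
    seq {set 'I_j} :=
  [seq B <- [seq widen_ord le_jm @^-1: B | B : {set 'I_m} <- c] | B != set0].

Lemma woc_restrict (j m : nat) (le_jm : j <= m) (c : seq {set 'I_m}) :
  is_woc c -> is_woc (restrict le_jm c).
Proof.
case/andP=> c_uniq /and3P[/eqP c_cov /trivIsetP c_triv c_n0].
have same (A B : {set 'I_m}) (i : 'I_m) :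
    A \in c -> B \in c -> i \in A -> i \in B -> A = B.
  move=> cA cB iA iB; apply/eqP; apply/negPn/negP => neAB.
  have := c_triv A B; rewrite !inE => /(_ cA cB neAB) /disjoint_setI0 AB0.
  by have := in_set0 i; rewrite -AB0 inE iA iB.
apply/andP; split.
  rewrite /restrict filter_map map_inj_in_uniq ?filter_uniq //.
  move=> A B; rewrite !mem_filter /= => /andP[/set0Pn[i iA] cA] /andP[_ cB] eqAB.
  have := iA; rewrite eqAB !inE => iB; rewrite inE in iA.
  exact: same iA iB.
apply/and3P; split; last by rewrite inE mem_filter eqxx.
  apply/eqP/setP=> i; rewrite inE.
  have: widen_ord le_jm i \in cover [set B in c] by rewrite c_cov inE.
  case/bigcupP=> B; rewrite inE => cB iB.
  apply/bigcupP; exists (widen_ord le_jm @^-1: B); last by rewrite inE.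
  rewrite inE mem_filter map_f // andbT.
  by apply/set0Pn; exists i; rewrite inE.
apply/trivIsetP=> A B; rewrite !inE !mem_filter.
move=> /andP[_ /mapP[A' cA ->]] /andP[_ /mapP[B' cB ->]] neAB.
rewrite -setI_eq0; apply/eqP/setP=> i; rewrite !inE.
apply/negP => /andP[iA iB]; case/eqP: neAB.
by rewrite (same _ _ _ cA cB iA iB).
Qed.

(** A stopping condition says which chains, on any number of variables,
    contain it. *)
Definition stopping_condition := forall m : nat, pred (seq {set 'I_m}).

(** Level [m] of the unbounded tree in which nodes containing the stopping
    condition have no descendants; the root is at level 1. *)
Definition restricted_level (stop : stopping_condition) (m : nat) :
    {set {bseq m of {set 'I_m}}} :=
  [set c in WOC m |
    [forall j : 'I_m, (0 < j) ==> ~~ stop j (restrict (ltnW (ltn_ord j)) c)]].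

Definition leaves_at (stop : stopping_condition) (n m : nat) :
    {set {bseq m of {set 'I_m}}} :=
  [set c in restricted_level stop m | (m == n) || stop m c].

Definition num_woc (stop : stopping_condition) (n : nat) : nat :=
  \sum_(1 <= m < n.+1) #|leaves_at stop n m|.

(** x_i < x_j in the chain; meaningful when both indices occur in [c]. *)
Definition chain_lt (m : nat) (c : seq {set 'I_m}) (i j : 'I_m) : bool :=
  find (fun B : {set 'I_m} => i \in B) c
    < find (fun B : {set 'I_m} => j \in B) c.

Definition has_ascent : stopping_condition := fun m c =>
  [exists i : 'I_m, exists j : 'I_m, (i < j) && chain_lt c i j].

(* Main.v *)
Require Import Defs.
From HB Require Import structures.
From mathcomp Require Import all_boot zify.

(** A chain without ascent satisfies [x_1 >= ... >= x_m].  If it has [k >= 1]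
    blocks, it has [2k + 1] children, exactly two of which have no ascent: those
    where the new variable joins the lowest block or forms a block below it.
    Let [D_m = 2 ^ (m - 1)] be the number of ascent-free chains at level [m], and
    [S_m] the sum of their numbers of blocks.  Then [S_(m+1) = 2 S_m + D_m], which
    is also the total number [L_(m+1)] of their children, and
    [w_n = L_n + \sum_(m < n) (L_m - D_m)]. *)

(** * Chains and ascents under restriction *)

(** Unlike the partition condition, this one is checked variable by variable, and restriction
    preserves the counts. Distinctness of the blocks is recovered because a repeated nonempty block
    would count its elements twice. *)
Lemma is_wocE (m : nat) (c : seq {set 'I_m}) :
  is_woc c = (set0 \notin c) &&
    [forall i, count (fun B : {set 'I_m} => i \in B) c == 1].
Proof.
apply/idP/andP => [/andP[c_uniq /and3P[/eqP c_cov /trivIsetP c_triv c_n0]]|].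
  split; first by rewrite inE in c_n0.
  apply/forallP => i.
  have: i \in cover [set B in c] by rewrite c_cov inE.
  case/bigcupP=> B; rewrite inE => cB iB.
  rewrite -(_ : count_mem B c = 1); last by rewrite count_uniq_mem // cB.
  apply/eqP/eq_in_count => A cA /=; apply/idP/eqP => [iA|-> //].
  apply/eqP/negPn/negP => neAB.
  have := c_triv A B; rewrite !inE => /(_ cA cB neAB) /disjoint_setI0 AB0.
  by have := in_set0 i; rewrite -AB0 inE iA iB.
case=> c_n0 /forallP c1.
have same (A B : {set 'I_m}) (i : 'I_m) :
    A \in c -> B \in c -> i \in A -> i \in B -> A = B.
  move=> cA cB iA iB; apply/eqP/negPn/negP => neAB.
  (* As [A] and [B] differ, they occupy two entries of [c] that contain [i], against the count 1. *)
  have := count_predUI (pred1 A) (pred1 B) c.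
  rewrite [X in _ + X](eq_count (a2 := pred0)) => [|D]; last first.
    by apply/andP => -[/eqP-> /eqP eqAB]; rewrite eqAB eqxx in neAB.
  rewrite count_pred0 addn0 => cAB.
  have le1 : count (predU (pred1 A) (pred1 B)) c <= 1.
    rewrite -(eqP (c1 i)); apply: sub_count => D /orP[]/eqP->//.
  move: cA cB; rewrite -!has_pred1 !has_count => cA cB.
  by have := leq_trans (leq_add cA cB) (eq_leq (esym cAB)); move/leq_trans/(_ le1).
apply/andP; split.
  apply: count_mem_uniq => A; case: (boolP (A \in c)) => [cA|/count_memPn//].
  have /set0Pn[i iA] : A != set0 by apply: contraNneq c_n0 => <-.
  apply/eqP; rewrite /= eqn_leq -has_count has_pred1 cA andbT -(eqP (c1 i)).
  by apply: sub_count => D /eqP->.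
apply/and3P; split; last by rewrite inE.
  apply/eqP/setP => i; rewrite inE.
  have: has (fun B : {set 'I_m} => i \in B) c by rewrite has_count (eqP (c1 i)).
  by case/hasP => B cB iB; apply/bigcupP; exists B; rewrite ?inE.
apply/trivIsetP => A B; rewrite !inE => cA cB neAB.
rewrite -setI_eq0; apply/eqP/setP => i; rewrite !inE.
apply/negP => /andP[iA iB]; case/eqP: neAB; exact: same iA iB.
Qed.

(** The deleted entries satisfy neither [a] nor [b], so they do not affect which is found first.
    This serves for the empty blocks that [restrict] removes. *)
Lemma find_filter_lt (T : Type) (p a b : pred T) (s : seq T) :
  subpred a p -> subpred b p ->
  (find a (filter p s) < find b (filter p s)) = (find a s < find b s).
Proof.
move=> ap bp; elim: s => //= x s IHs.
case px: (p x) => /=; first by case: (a x); case: (b x).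
have -> : a x = false by apply: contraFF px; apply: ap.
by have -> : b x = false by apply: contraFF px; apply: bp.
Qed.

Lemma chain_lt_restrict (j m : nat) (le_jm : j <= m) (c : seq {set 'I_m})
    (i k : 'I_j) :
  chain_lt (restrict le_jm c) i k =
  chain_lt c (widen_ord le_jm i) (widen_ord le_jm k).
Proof.
rewrite /chain_lt /restrict find_filter_lt ?find_map.
- by congr (_ < _); apply: eq_find => B /=; rewrite inE.
- by move=> B iB; apply/set0Pn; exists i.
- by move=> B kB; apply/set0Pn; exists k.
Qed.

(** Ascents of every ancestor are expressed on the variables of [c] itself, where the condition is
    visibly monotone in [j]. *)
Lemma has_ascent_restrict (j m : nat) (le_jm : j <= m) (c : seq {set 'I_m}) :
  has_ascent (restrict le_jm c) =
  [exists i : 'I_m, exists k : 'I_m, [&& k < j, i < k & chain_lt c i k]].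
Proof.
apply/existsP/existsP => -[i /existsP[k]].
  rewrite chain_lt_restrict => ik; exists (widen_ord le_jm i).
  by apply/existsP; exists (widen_ord le_jm k); rewrite /= ltn_ord.
have widenE (l : 'I_m) (lj : l < j) : widen_ord le_jm (Ordinal lj) = l.
  exact: val_inj.
case/and3P=> kj ik lt_ik; exists (Ordinal (ltn_trans ik kj)).
by apply/existsP; exists (Ordinal kj); rewrite ik chain_lt_restrict !widenE.
Qed.

Lemma count_restrict (j m : nat) (le_jm : j <= m) (c : seq {set 'I_m}) (i : 'I_j) :
  count (fun B : {set 'I_j} => i \in B) (restrict le_jm c) =
  count (fun B : {set 'I_m} => widen_ord le_jm i \in B) c.
Proof.
rewrite /restrict count_filter count_map; apply: eq_count => B /=.
rewrite inE; case iB: (_ \in B) => //=.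
by apply/set0Pn; exists i; rewrite inE.
Qed.

Lemma set0_restrict (j m : nat) (le_jm : j <= m) (c : seq {set 'I_m}) :
  set0 \notin restrict le_jm c.
Proof. by rewrite mem_filter eqxx. Qed.

(** By monotonicity, an ascent of any ancestor is still present in the parent, so testing the parent
    suffices. *)
Lemma restricted_level_ascent (m : nat) (c : {bseq m.+1 of {set 'I_m.+1}}) :
  (c \in restricted_level has_ascent m.+1) =
  is_woc c && ~~ has_ascent (restrict (leqnSn m) c).
Proof.
rewrite !inE; congr (_ && _); apply/forallP/idP => [noasc|noasc j].
  have := noasc ord_max; rewrite /= !has_ascent_restrict.
  (* For [m = 0] the guard [0 < j] fails, but a chain on no variables has no ascent anyway. *)
  case: m c {noasc} => [|m] c //= _.
  by apply/existsP => -[i /existsP[k]].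
apply/implyP => _; apply: contra noasc; rewrite !has_ascent_restrict.
case/existsP=> i /existsP[k /and3P[kj ik lt_ik]].
apply/existsP; exists i; apply/existsP; exists k; rewrite ik lt_ik !andbT.
by rewrite (leq_trans kj) // -ltnS.
Qed.

(** * Insertion of the last variable *)

Definition widen_block (m : nat) (B : {set 'I_m}) : {set 'I_m.+1} :=
  widen_ord (leqnSn m) @: B.

(** The new variable goes from the bottom up: alone below [B], inside [B], or somewhere above [B];
    the base case makes it a new top block. In this order the insertions that create no ascent come
    first. *)
Fixpoint children (m : nat) (c : seq {set 'I_m}) : seq (seq {set 'I_m.+1}) :=
  if c is B :: s then
    [:: [set ord_max] :: map (@widen_block m) c,
        (ord_max |: widen_block m B) :: map (@widen_block m) s
      & [seq widen_block m B :: c' | c' <- children m s]]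
  else [:: [:: [set ord_max]]].

Lemma size_children (m : nat) (c : seq {set 'I_m}) :
  size (children m c) = (size c).*2.+1.
Proof. by elim: c => //= B s IHs; rewrite size_map IHs doubleS. Qed.

Lemma max_widen_block (m : nat) (B : {set 'I_m}) :
  (ord_max \in widen_block m B) = false.
Proof.
apply/imsetP => -[i _ /(congr1 val) /= im].
by have := ltn_ord i; rewrite -im ltnn.
Qed.

Lemma mem_widen_block (m : nat) (B : {set 'I_m}) (i : 'I_m) :
  (widen_ord (leqnSn m) i \in widen_block m B) = (i \in B).
Proof. by apply: mem_imset => x y /(congr1 val) /= /val_inj. Qed.

Lemma ord_maxVwiden (m : nat) (i : 'I_m.+1) :
  i = ord_max \/ exists j, i = widen_ord (leqnSn m) j.
Proof.
case: (ltnP i m) => im; [right; exists (Ordinal im)|left]; apply: val_inj => //=.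
by apply/eqP; rewrite eqn_leq im -ltnS ltn_ord.
Qed.

Lemma widen_blockK (m : nat) (B : {set 'I_m}) :
  widen_ord (leqnSn m) @^-1: widen_block m B = B.
Proof. by apply/setP => i; rewrite inE mem_widen_block. Qed.

Lemma preim_max (m : nat) (A : {set 'I_m.+1}) :
  widen_ord (leqnSn m) @^-1: (ord_max |: A) = widen_ord (leqnSn m) @^-1: A.
Proof.
apply/setP => i; rewrite !inE (_ : (_ == _) = false) //.
by apply/eqP => /(congr1 val) /= im; have := ltn_ord i; rewrite im ltnn.
Qed.

Lemma preim_blockK (m : nat) (A : {set 'I_m.+1}) :
  ord_max \notin A -> widen_block m (widen_ord (leqnSn m) @^-1: A) = A.
Proof.
move=> /negPf maxA; apply/setP => i; case: (ord_maxVwiden m i) => [|[j]] ->.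
  by rewrite max_widen_block maxA.
by rewrite mem_widen_block inE.
Qed.

Lemma widen_block_eq0 (m : nat) (B : {set 'I_m}) :
  (widen_block m B == set0) = (B == set0).
Proof. exact: imset_eq0. Qed.

Lemma preim_block_eq0 (m : nat) (A : {set 'I_m.+1}) :
  ord_max \notin A -> (widen_ord (leqnSn m) @^-1: A == set0) = (A == set0).
Proof. by move=> maxA; rewrite -(widen_block_eq0 m) preim_blockK. Qed.

Lemma restrict_map_widen (m : nat) (c : seq {set 'I_m}) :
  set0 \notin c -> restrict (leqnSn m) (map (@widen_block m) c) = c.
Proof.
elim: c => //= B s IHs; rewrite inE negb_or eq_sym => /andP[B0 s0].
rewrite /restrict /= widen_blockK B0; congr (_ :: _); exact: IHs.
Qed.

Lemma map_widen_restrict (m : nat) (c : seq {set 'I_m.+1}) :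
  set0 \notin c -> count (fun B : {set 'I_m.+1} => ord_max \in B) c = 0 ->
  map (@widen_block m) (restrict (leqnSn m) c) = c.
Proof.
elim: c => //= A t IHt; rewrite inE negb_or eq_sym => /andP[A0 t0].
move/eqP; rewrite addn_eq0 eqb0 => /andP[maxA /eqP max_t].
rewrite /restrict /= preim_block_eq0 // A0 /= preim_blockK //.
congr (_ :: _); exact: IHt.
Qed.

Lemma count_map_widen (m : nat) (c : seq {set 'I_m}) :
  count (fun B : {set 'I_m.+1} => ord_max \in B) (map (@widen_block m) c) = 0.
Proof.
rewrite count_map (eq_count (a2 := pred0)) ?count_pred0 // => B.
exact: max_widen_block.
Qed.

Lemma set0_map_widen (m : nat) (c : seq {set 'I_m}) :
  set0 \notin c -> set0 \notin map (@widen_block m) c.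
Proof.
by apply: contra => /mapP[B cB /esym/eqP]; rewrite widen_block_eq0 => /eqP <-.
Qed.

Lemma max_setU1_neq0 (m : nat) (A : {set 'I_m.+1}) : (set0 == ord_max |: A) = false.
Proof. by apply/eqP => /setP/(_ ord_max); rewrite !inE eqxx. Qed.

Lemma childrenP (m : nat) (c : seq {set 'I_m}) (c' : seq {set 'I_m.+1}) :
  set0 \notin c -> c' \in children m c ->
  [/\ set0 \notin c', count (fun B : {set 'I_m.+1} => ord_max \in B) c' = 1
    & restrict (leqnSn m) c' = c].
Proof.
(* A new singleton block is treated as an insertion into an empty block. *)
have set1E : [set ord_max] = ord_max |: set0 :> {set 'I_m.+1} by rewrite setU0.
elim: c c' => [|B s IHs] c'.
  rewrite inE => _ /eqP ->; rewrite set1E inE max_setU1_neq0; split=> //=.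
    by rewrite !inE eqxx.
  by rewrite /restrict /= preim_max preimset0 eqxx.
move=> c0; have := c0; rewrite inE negb_or eq_sym => /andP[B0 s0].
rewrite !inE => /or3P[/eqP->|/eqP->|/mapP[t tP ->]].
- rewrite set1E; split.
  + by rewrite inE max_setU1_neq0 set0_map_widen.
  + by rewrite /= count_map_widen max_widen_block !inE eqxx.
  rewrite -[RHS](restrict_map_widen m (B :: s)) //.
  by rewrite [LHS]/restrict /= preim_max preimset0 eqxx.
- split.
  + by rewrite inE max_setU1_neq0 set0_map_widen.
  + by rewrite /= count_map_widen !inE eqxx.
  rewrite /restrict /= preim_max widen_blockK B0; congr (_ :: _).
  exact: restrict_map_widen.
have [t0 t1 tr] := IHs t s0 tP; split.
- by rewrite inE negb_or eq_sym widen_block_eq0 B0.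
- by rewrite /= max_widen_block t1.
by rewrite /restrict /= widen_blockK B0; congr (_ :: _).
Qed.

(** Peel off blocks until one contains [ord_max]. Under restriction that block either disappears or
    loses just this element; these are the first two insertions in [children]. *)
Lemma mem_children_restrict (m : nat) (c : seq {set 'I_m.+1}) :
  set0 \notin c -> count (fun B : {set 'I_m.+1} => ord_max \in B) c = 1 ->
  c \in children m (restrict (leqnSn m) c).
Proof.
elim: c => //= A t IHt; rewrite inE negb_or eq_sym => /andP[A0 t0].
rewrite /restrict /= -/(restrict (leqnSn m) t).
case maxA: (ord_max \in A) => /=; last first.
  rewrite add0n => max_t.
  rewrite preim_block_eq0 ?maxA // A0 /= preim_blockK ?maxA //.
  by rewrite !inE map_f ?orbT //; apply: IHt.
case=> max_t; have tE := map_widen_restrict m t t0 max_t.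
have AE : A = ord_max |: widen_block m (widen_ord (leqnSn m) @^-1: A).
  rewrite -{1}(setD1K maxA) -{2}(setD1K maxA) preim_max preim_blockK //.
  by rewrite !inE eqxx.
case: eqP => [A'0|_] /=; last by rewrite tE -AE !inE eqxx orbT.
rewrite {1}AE A'0 /widen_block imset0 setU0 -{1}tE.
(* The restricted tail is split because [children] treats the empty chain separately. *)
by case: (restrict _ t) => [|B s]; rewrite /= inE eqxx.
Qed.

Lemma is_woc_restrict (m : nat) (c : seq {set 'I_m.+1}) :
  is_woc c = [&& set0 \notin c,
    count (fun B : {set 'I_m.+1} => ord_max \in B) c == 1
    & is_woc (restrict (leqnSn m) c)].
Proof.
rewrite !is_wocE set0_restrict /=; congr (_ && _).
apply/forallP/andP => [c1|[max1 /forallP c1] i].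
  by split=> //; apply/forallP => i; rewrite count_restrict.
by case: (ord_maxVwiden m i) => [->//|[j ->]]; rewrite -count_restrict.
Qed.

(** Lists the fibre of restriction over [c], so that the tree, defined through restriction, can be
    enumerated downwards. *)
Lemma mem_children (m : nat) (c : seq {set 'I_m}) (c' : seq {set 'I_m.+1}) :
  is_woc c ->
  (c' \in children m c) = is_woc c' && (restrict (leqnSn m) c' == c).
Proof.
move=> c_woc; have c0 : set0 \notin c by have := c_woc; rewrite is_wocE => /andP[].
rewrite is_woc_restrict; apply/idP/andP => [/(childrenP _ _ _ c0)[-> -> ->]|].
  by rewrite eqxx.
by case=> /and3P[c'0 /eqP c'1 _] /eqP <-; apply: mem_children_restrict.
Qed.

Lemma uniq_children (m : nat) (c : seq {set 'I_m}) :
  set0 \notin c -> uniq (children m c).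
Proof.
elim: c => //= B s IHs; rewrite inE negb_or eq_sym => /andP[B0 s0].
rewrite map_inj_uniq ?IHs ?andbT // => [|? ? []//].
rewrite inE negb_or -andbA; apply/and3P; split.
(* If the first two children agreed, [B] would be empty. The remaining ones differ from both, as
   their lowest block lacks [ord_max]. *)
- apply: contra B0 => /eqP[/setP eqB _]; rewrite -widen_block_eq0.
  apply/eqP/setP => i; rewrite inE; have := eqB i; rewrite !inE.
  by case: eqP => // ->; rewrite max_widen_block.
- apply/mapP => -[t _ [/setP/(_ ord_max)]].
  by rewrite max_widen_block !inE eqxx.
- apply/mapP => -[t _ [/setP/(_ ord_max)]].
  by rewrite max_widen_block !inE eqxx.
Qed.

(* The first two children are those with the new variable in the lowest block;
   the empty chain has only one child. *)
Definition bottom_children (m : nat) (c : seq {set 'I_m}) := take 2 (children m c).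

Lemma mem_bottom_children (m : nat) (c : seq {set 'I_m}) (c' : seq {set 'I_m.+1}) :
  (c' \in bottom_children m c) = (c' \in children m c) && (ord_max \in head set0 c').
Proof.
case: c => [|B s]; rewrite /bottom_children /= ?take0 !inE.
  by case: eqP => // -> /=; rewrite inE eqxx.
do 2![case: eqP => [->|_] /=; first by rewrite !inE eqxx].
by case: mapP => // -[t _ ->]; rewrite /= max_widen_block.
Qed.

(** * Enumeration of the ascent-free chains and their children *)

(** If the last variable is not in the lowest block, any element of that block forms an ascent with
    it. If it is, no ascent ends at it, and every other ascent is already in the restriction. *)
Lemma has_ascent_head (m : nat) (c : seq {set 'I_m.+1}) :
  is_woc c ->
  ~~ has_ascent c =
  ~~ has_ascent (restrict (leqnSn m) c) && (ord_max \in head set0 c).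
Proof.
rewrite is_wocE has_ascent_restrict => /andP[c0 /forallP c1].
apply/idP/andP => [noasc|[noasc maxc]].
  split; apply: contraR noasc.
    rewrite negbK => /existsP[i /existsP[k /and3P[_ ik lt_ik]]].
    by apply/existsP; exists i; apply/existsP; exists k; rewrite ik.
  case: c c0 c1 => [|B s] /=; first by move=> _ /(_ ord_max).
  rewrite inE negb_or eq_sym => /andP[/set0Pn[i iB] _] _ maxB.
  apply/existsP; exists i; apply/existsP; exists ord_max.
  rewrite /chain_lt /= iB (negPf maxB) andbT ltn_neqAle -ltnS ltn_ord andbT.
  by apply: contraNneq maxB => im; rewrite (_ : ord_max = i) //; apply: val_inj.
apply: contra noasc => /existsP[i /existsP[k /andP[ik lt_ik]]].
apply/existsP; exists i; apply/existsP; exists k; rewrite ik lt_ik !andbT.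
have: k != ord_max.
  (* The block of [ord_max] is found at position 0, and no position lies below that. *)
  apply: contraTneq lt_ik => ->; case: c maxc {c0 c1} => [|B s] /=.
    by rewrite inE.
  by rewrite /chain_lt /= => ->.
by case: (ord_maxVwiden m k) => [->|[j -> _]]; rewrite ?eqxx //=.
Qed.

(** The recursion starts one level above the root, at the empty chain. That chain has a single
    child, so doubling begins only at level 1. *)
Fixpoint ascent_free (m : nat) : seq (seq {set 'I_m}) :=
  if m is m'.+1 then flatten [seq bottom_children m' c | c <- ascent_free m']
  else [:: [::]].

(** Only ascent-free nodes have descendants, so this enumerates the restricted level [m.+1]. *)
Definition ascent_free_children (m : nat) : seq (seq {set 'I_m.+1}) :=
  flatten [seq children m c | c <- ascent_free m].

Lemma mem_ascent_free (m : nat) (c : seq {set 'I_m}) :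
  (c \in ascent_free m) = is_woc c && ~~ has_ascent c.
Proof.
elim: m c => [|m IHm] c.
  (* Over ['I_0] every block would be empty, so the only chain is the empty one. *)
  rewrite inE is_wocE; case: c => [|B s] /=.
    by rewrite (introT forallP) => [|[]//]; apply/esym/existsP => -[[]].
  by rewrite inE (_ : set0 = B) ?eqxx //; apply/setP => -[].
apply/flatten_mapP/andP => [[c']|[c_woc]].
  rewrite IHm mem_bottom_children => /andP[c'_woc noasc].
  rewrite mem_children // => /andP[/andP[c_woc /eqP cr] max_c].
  by rewrite c_woc has_ascent_head // cr noasc.
rewrite has_ascent_head // => /andP[noasc max_c].
have c'_woc := woc_restrict (leqnSn m) c_woc.
exists (restrict (leqnSn m) c); first by rewrite IHm c'_woc.
by rewrite mem_bottom_children mem_children // c_woc eqxx.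
Qed.

Lemma mem_ascent_free_children (m : nat) (c : seq {set 'I_m.+1}) :
  (c \in ascent_free_children m) =
  is_woc c && ~~ has_ascent (restrict (leqnSn m) c).
Proof.
apply/flatten_mapP/andP => [[c']|[c_woc noasc]].
  rewrite mem_ascent_free => /andP[c'_woc noasc].
  by rewrite mem_children // => /andP[-> /eqP ->].
have c'_woc := woc_restrict (leqnSn m) c_woc.
exists (restrict (leqnSn m) c); first by rewrite mem_ascent_free c'_woc.
by rewrite mem_children // c_woc eqxx.
Qed.

(** * Cardinalities of the levels *)

(** Since [f] recovers [x] from any element of [g x], distinct entries of [s] have disjoint lists.
    Below, [f] is restriction to the parent. *)
Lemma uniq_flatten_fibers (T U : eqType) (f : U -> T) (g : T -> seq U) (s : seq T) :
  uniq s -> {in s, forall x, uniq (g x)} ->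
  {in s, forall x, {in g x, forall y, f y = x}} -> uniq (flatten (map g s)).
Proof.
elim: s => //= x s IHs /andP[xs s_uniq] g_uniq fg; rewrite cat_uniq.
rewrite g_uniq ?mem_head //= IHs // ?andbT; first last.
- by move=> y ys; apply: fg; rewrite inE ys orbT.
- by move=> y ys; apply: g_uniq; rewrite inE ys orbT.
apply/hasPn => z /flatten_mapP[y ys zy]; apply: contra xs => zx.
by rewrite -(fg x _ z zx) ?mem_head // (fg y _ z zy) // inE ys orbT.
Qed.

Lemma set0_ascent_free (m : nat) (c : seq {set 'I_m}) :
  c \in ascent_free m -> set0 \notin c.
Proof. by rewrite mem_ascent_free is_wocE -andbA => /and3P[]. Qed.

Lemma uniq_ascent_free (m : nat) : uniq (ascent_free m).
Proof.
elim: m => //= m IHm.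
apply: (uniq_flatten_fibers _ _ (restrict (leqnSn m))) => // c /set0_ascent_free c0.
  exact/take_uniq/uniq_children.
by move=> c' /mem_take /(childrenP _ _ _ c0)[].
Qed.

Lemma uniq_ascent_free_children (m : nat) : uniq (ascent_free_children m).
Proof.
apply: (uniq_flatten_fibers _ _ (restrict (leqnSn m))).
- exact: uniq_ascent_free.
- by move=> c /set0_ascent_free; apply: uniq_children.
by move=> c /set0_ascent_free c0 c' /(childrenP _ _ _ c0)[].
Qed.

(** Links levels, which are sets of bounded sequences, to enumerations by plain sequences; the size
    bound lifts each listed chain. *)
Lemma card_bseq (T : finType) (n : nat) (A : {set {bseq n of T}}) (s : seq (seq T)) :
  uniq s -> {in s, forall c, size c <= n} ->
  (forall c : {bseq n of T}, (c \in A) = (val c \in s)) -> #|A| = size s.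
Proof.
move=> s_uniq s_size As; rewrite cardE -(size_map val); apply: perm_size.
apply: uniq_perm => //; first by rewrite (map_inj_uniq val_inj) enum_uniq.
move=> c; apply/mapP/idP => [[c' + ->]|cs]; first by rewrite mem_enum As.
by exists (Bseq (s_size _ cs)); rewrite // mem_enum As.
Qed.

Lemma card_restricted_level (m : nat) :
  #|restricted_level has_ascent m.+1| = size (ascent_free_children m).
Proof.
apply: card_bseq; first exact: uniq_ascent_free_children.
  by move=> c; rewrite mem_ascent_free_children => /andP[/size_woc].
by move=> c; rewrite restricted_level_ascent mem_ascent_free_children.
Qed.

Lemma card_ascent_free_level (m : nat) :
  #|[set c in restricted_level has_ascent m.+1 | ~~ has_ascent c]| =
  size (ascent_free m.+1).
Proof.
apply: card_bseq; first exact: uniq_ascent_free.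
  by move=> c; rewrite mem_ascent_free => /andP[/size_woc].
move=> c; rewrite inE restricted_level_ascent mem_ascent_free -andbA.
(* An ascent-free chain has an ascent-free parent, so the condition on the parent is absorbed. *)
by case c_woc: (is_woc c) => //=; rewrite has_ascent_head // andbA andbb.
Qed.

(** * Recurrences and summation *)

Lemma size_flatten_map (T U : Type) (g : T -> seq U) (s : seq T) :
  size (flatten (map g s)) = \sum_(x <- s) size (g x).
Proof. by rewrite size_flatten /shape -map_comp sumnE big_map. Qed.

(** A nonempty chain with [k] blocks has bottom children with [k + 1] and [k] blocks. Taking [F]
    constant 1 gives the recurrence for [D], and the identity gives that for [S]. *)
Lemma sum_ascent_freeS (m : nat) (F : nat -> nat) :
  \sum_(c <- ascent_free m.+2) F (size c) =
  \sum_(c <- ascent_free m.+1) (F (size c).+1 + F (size c)).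
Proof.
rewrite /= big_flatten big_map; apply: eq_big_seq => c.
rewrite -/(ascent_free m.+1) mem_ascent_free is_wocE -andbA => /and3P[_ /forallP c1 _].
(* The empty chain is excluded because [x_1] must occur. *)
case: c c1 => [/(_ ord0)//|B s _].
by rewrite /bottom_children /= take0 !big_cons big_nil /= !size_map addn0.
Qed.

Lemma size_ascent_free (m : nat) : size (ascent_free m.+1) = 2 ^ m.
Proof.
elim: m => [//|m IHm].
rewrite -sum1_size (sum_ascent_freeS m (fun=> 1)) big_split /= -/(ascent_free m.+1) !sum1_size.
by rewrite IHm addnn -mul2n expnS.
Qed.

(** Doubling avoids the exponent [m - 1] in the closed form of [S_(m+1)]. *)
Lemma sum_size_ascent_free (m : nat) :
  (\sum_(c <- ascent_free m.+1) size c).*2 = m.+2 * 2 ^ m.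
Proof.
elim: m => [|m IHm]; first by rewrite big_seq1.
rewrite (sum_ascent_freeS m id) big_split /=.
under eq_bigr do rewrite -add1n.
rewrite big_split /= -/(ascent_free m.+1) sum1_size size_ascent_free expnS; lia.
Qed.

(** This is [L_(m+1) = 2 S_m + D_m], with the single child of the empty chain treated apart at
    [m = 0]. *)
Lemma size_ascent_free_children (m : nat) :
  (size (ascent_free_children m)).*2 = m.+2 * 2 ^ m.
Proof.
rewrite size_flatten_map; under eq_bigr do rewrite size_children -addn1 -addnn.
rewrite !big_split /= sum1_size; case: m => [|m]; first by rewrite big_seq1.
by have := sum_size_ascent_free m; rewrite size_ascent_free expnS; lia.
Qed.

Lemma leaves_at_top (n : nat) (stop : stopping_condition) :
  leaves_at stop n n = restricted_level stop n.
Proof. by apply/setP => c; rewrite [LHS]inE eqxx andbT. Qed.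

(** Away from level [n] the leaves are the nodes with an ascent, [L_(m+1) - D_(m+1)] in number;
    doubled, [(m + 2) 2^m - 2 * 2^m]. *)
Lemma card_leaves_below (n m : nat) :
  m.+1 != n -> (#|leaves_at has_ascent n m.+1|).*2 = m * 2 ^ m.
Proof.
move=> /negPf mn.
have := size_ascent_free_children m; rewrite -card_restricted_level.
rewrite -(cardsID [set c : {bseq m.+1 of {set 'I_m.+1}} | has_ascent c]).
have -> : restricted_level has_ascent m.+1 :&:
    [set c : {bseq m.+1 of {set 'I_m.+1}} | has_ascent c] =
    leaves_at has_ascent n m.+1.
  by apply/setP => c; rewrite [RHS]inE mn in_setI (in_set (fun c => has_ascent _)).
have := card_ascent_free_level m; rewrite size_ascent_free.
have -> : [set c in restricted_level has_ascent m.+1 | ~~ has_ascent c] =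
    restricted_level has_ascent m.+1 :\:
    [set c : {bseq m.+1 of {set 'I_m.+1}} | has_ascent c].
  by apply/setP => c; rewrite in_setD andbC [LHS]inE (in_set (fun c => has_ascent _)).
by move=> ->; move: #|_| (2 ^ m) => x p; lia.
Qed.

(** The sum of [j 2^j] over [j < k] is [(k - 2) 2^k + 2]; the negative term is moved to the left to
    avoid truncated subtraction. *)
Lemma sum_leaves_below (n k : nat) :
  k < n ->
  (\sum_(1 <= m < k.+1) #|leaves_at has_ascent n m|).*2 + 2 ^ k.+1 = k * 2 ^ k + 2.
Proof.
elim: k => [|k IHk] kn; first by rewrite big_nil.
rewrite big_nat_recr //= doubleD card_leaves_below ?ltn_eqF //.
by have := IHk (ltnW kn); rewrite !expnS; move: (\sum_(_ <= _ < _) _) (2 ^ k) => S p; lia.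
Qed.

Lemma num_woc_ascent (n : nat) : num_woc has_ascent n.+1 = n * 2 ^ n + 1.
Proof.
rewrite /num_woc big_nat_recr //= leaves_at_top card_restricted_level.
have := sum_leaves_below n.+1 n (ltnSn n).
have := size_ascent_free_children n; rewrite expnS.
(* Doubled, the total is [(n - 2) 2^n + 2] from the lower levels plus [(n + 2) 2^n] from the top
   one. *)
by move: (\sum_(_ <= _ < _) _) (size _) (2 ^ n) => S l p; lia.
Qed.

Theorem theorem2 :
  (forall n : nat, 1 <= n ->
     num_woc has_ascent n = (n - 1) * 2 ^ (n - 1) + 1)
  /\ [seq num_woc has_ascent n | n <- iota 1 8]
       = [:: 1; 3; 9; 25; 65; 161; 385; 897].
Proof.
split=> [[//|n] _|]; first by rewrite subn1 num_woc_ascent.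
by rewrite /= !num_woc_ascent.
Qed.
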